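(* Let $w_1,w_2,w_3,w^R_{12},w^I_{12},w^R_{23},w^I_{23},w^R_{31},w^I_{31}$ be real numbers and let $W$ be the Hermitian $3\times3$ matrix with $W_{ii}=w_i$, $W_{12}=w^R_{12}+\mathbf i w^I_{12}$, $W_{23}=w^R_{23}+\mathbf i w^I_{23}$, $W_{31}=w^R_{31}+\mathbf i w^I_{31}$ and $W_{ji}=W_{ij}^*$. Suppose that the second-order cone constraints $$w_i\ge0,\qquad w_iw_j\ge|W_{ij}|^2\qquad\text{for }(i,j)\in\{(1,2),(2,3),(1,3)\}$$ hold, and that the three-bus cycle constraints $$w^R_{31}w^R_{23}-w^I_{31}w^I_{23}=w_3w^R_{12},\qquad w^I_{31}w^R_{23}+w^R_{31}w^I_{23}=-w_3w^I_{12},$$ $$w^R_{31}w^R_{12}-w^I_{31}w^I_{12}=w_1w^R_{23},\qquad w^I_{31}w^R_{12}+w^R_{31}w^I_{12}=-w_1w^I_{23}$$ hold. Then $\det(W)\ge0$, and hence $W\succeq0$. In other words, for three-dimensional cycles the semidefinite constraint $W\succeq0$ is a relaxation of the cycle constraints combined with the second-order cone constraints.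
   Context: $\mathbf i$ is the imaginary unit, $z^*$ is complex conjugation, and $W\succeq0$ means that $W$ is positive semidefinite. The cycle constraints are the real and imaginary parts of $W_{31}W_{23}=w_3W_{12}^*$ and $W_{31}W_{12}=w_1W_{23}^*$, which express Kirchhoff's Voltage Law on the cycle $\{(1,2),(2,3),(3,1)\}$ in terms of $W_{ij}=V_iV_j^*$ for complex node voltages $V_i$. *)

(* Defs.v *)
From HB Require Import structures.
From mathcomp Require Import all_boot all_order all_algebra.
From mathcomp Require Import sesquilinear spectral complex reals.

Set Implicit Arguments.
Unset Strict Implicit.
Unset Printing Implicit Defensive.

Import Order.TTheory GRing.Theory Num.Theory.
Local Open Scope ring_scope.
Local Open Scope complex_scope.
Local Open Scope sesquilinear_scope.

(* In a numClosedFieldType, [0 <= z] means that z is real and nonnegative. *)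
Definition psdmx (C : numClosedFieldType) (n : nat) (A : 'M[C]_n) : Prop :=
  A \is hermsymmx /\ forall u : 'cV[C]_n, 0 <= (u ^t* *m A *m u) 0 0.

(* Buses 1, 2, 3 are the indices 0, 1, 2 of 'I_3. The off-diagonal data are
   W12, W23 and W31, oriented along the cycle (1,2), (2,3), (3,1). *)
Definition busmx (R : realType) (w1 w2 w3 : R) (W12 W23 W31 : R[i]) :
    'M[R[i]]_3 :=
  \matrix_(i < 3, j < 3)
    nth 0 (nth [::] [:: [:: w1%:C;  W12;    W31^* ];
                        [:: W12^*;  w2%:C;  W23   ];
                        [:: W31;    W23^*;  w3%:C ]] i) j.

(* Main.v *)
(* The cycle equations give [W12 W23 W31 = w3 |W12|^2 = w1 |W23|^2], so that
   [det W = w2 (w1 w3 - |W31|^2)].  Moreover the equation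
   [W31 W12 = w1 W23^*] says that the Schur complement of the pivot w1 is
   diagonal: w1 times the quadratic form of W at (x, y, z) equals
   [|w1 x + W12 y + W31^* z|^2 + (w1 w2 - |W12|^2) |y|^2
    + (w1 w3 - |W31|^2) |z|^2].
   If w1 = 0, the first row and column vanish and a 2x2 block remains. *)
Require Import Defs.
From mathcomp Require Import all_boot all_order all_algebra.
From mathcomp Require Import complex reals.
From mathcomp Require Import ring sesquilinear spectral.

Import Order.TTheory GRing.Theory Num.Theory.
Local Open Scope ring_scope.
Local Open Scope complex_scope.

Lemma sumsqr_le0 (R : realDomainType) (a b : R) :
  a ^+ 2 + b ^+ 2 <= 0 -> a = 0 /\ b = 0.
Proof.
move=> h; have : a ^+ 2 + b ^+ 2 == 0 by rewrite eq_le h addr_ge0 ?sqr_ge0.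
by rewrite paddr_eq0 ?sqr_ge0 // !sqrf_eq0 => /andP[/eqP-> /eqP->].
Qed.

(** Completing the square: for [p > 0], [p] times the form is [|p y + b z|^2 + (p q - |b|^2) |z|^2],
    written in real coordinates; [p = 0] forces [b = 0]. *)
Lemma hermitian_form2_ge0 (R : realFieldType) (p q b1 b2 y1 y2 z1 z2 : R) :
  0 <= p -> 0 <= q -> b1 ^+ 2 + b2 ^+ 2 <= p * q ->
  0 <= p * (y1 ^+ 2 + y2 ^+ 2) + q * (z1 ^+ 2 + z2 ^+ 2)
       + 2 * (b1 * (y1 * z1 + y2 * z2) + b2 * (y2 * z1 - y1 * z2)).
Proof.
rewrite [0 <= p]le_eqVlt => /predU1P[<-|p_gt0] q_ge0 hb.
  rewrite mul0r in hb; have [-> ->] := sumsqr_le0 _ _ _ hb.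
  by rewrite !mul0r add0r addr0 mulr0 addr0 mulr_ge0 ?addr_ge0 ?sqr_ge0.
rewrite -(pmulr_rge0 _ p_gt0).
set Q := (X in 0 <= X).
have -> : Q = (p * y1 + b1 * z1 - b2 * z2) ^+ 2
    + (p * y2 + b1 * z2 + b2 * z1) ^+ 2
    + (p * q - (b1 ^+ 2 + b2 ^+ 2)) * (z1 ^+ 2 + z2 ^+ 2).
  by rewrite /Q; ring.
by rewrite !addr_ge0 ?sqr_ge0 ?mulr_ge0 ?subr_ge0 ?addr_ge0 ?sqr_ge0.
Qed.

(** Real coordinates for the form of [busmx], with [a], [b], [c] for [W12], [W23], [W31]; the two
    equations read [w1 b = (c a)^*]. *)
Lemma hermitian_form3_ge0 (R : realFieldType)
    (w1 w2 w3 a1 a2 b1 b2 c1 c2 x1 x2 y1 y2 z1 z2 : R) :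
  0 <= w1 -> 0 <= w2 -> 0 <= w3 ->
  a1 ^+ 2 + a2 ^+ 2 <= w1 * w2 -> b1 ^+ 2 + b2 ^+ 2 <= w2 * w3 ->
  c1 ^+ 2 + c2 ^+ 2 <= w1 * w3 ->
  w1 * b1 = c1 * a1 - c2 * a2 -> w1 * b2 = - (c2 * a1 + c1 * a2) ->
  0 <= w1 * (x1 ^+ 2 + x2 ^+ 2) + w2 * (y1 ^+ 2 + y2 ^+ 2)
       + w3 * (z1 ^+ 2 + z2 ^+ 2)
       + 2 * (a1 * (x1 * y1 + x2 * y2) + a2 * (x2 * y1 - x1 * y2))
       + 2 * (b1 * (y1 * z1 + y2 * z2) + b2 * (y2 * z1 - y1 * z2))
       + 2 * (c1 * (z1 * x1 + z2 * x2) + c2 * (z2 * x1 - z1 * x2)).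
Proof.
rewrite [0 <= w1]le_eqVlt => /predU1P[<-|w1_gt0] w2_ge0 w3_ge0 ha hb hc e1 e2.
  rewrite !mul0r in ha hc *.
  have [-> ->] := sumsqr_le0 _ _ _ ha; have [-> ->] := sumsqr_le0 _ _ _ hc.
  rewrite !mul0r !addr0 !mulr0 add0r !addr0.
  exact: hermitian_form2_ge0.
rewrite -(pmulr_rge0 _ w1_gt0).
set Q := (X in 0 <= X).
have -> : Q = (w1 * x1 + a1 * y1 - a2 * y2 + c1 * z1 + c2 * z2) ^+ 2
    + (w1 * x2 + a1 * y2 + a2 * y1 + c1 * z2 - c2 * z1) ^+ 2
    + (w1 * w2 - (a1 ^+ 2 + a2 ^+ 2)) * (y1 ^+ 2 + y2 ^+ 2)
    + (w1 * w3 - (c1 ^+ 2 + c2 ^+ 2)) * (z1 ^+ 2 + z2 ^+ 2).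
  (* The first two squares contribute the cross term [2 Re (a^* c^* y^* z)], which [e1] and [e2]
     identify with [2 w1 Re (b y^* z)]. *)
  by rewrite /Q; ring: e1 e2.
by rewrite !addr_ge0 ?sqr_ge0 ?mulr_ge0 ?subr_ge0 ?addr_ge0 ?sqr_ge0.
Qed.

Lemma det_mx33 (R : comNzRingType) (A : 'M[R]_3) :
  \det A = A 0 0 * (A 1 1 * A 2 2 - A 1 2 * A 2 1)
         - A 0 1 * (A 1 0 * A 2 2 - A 1 2 * A 2 0)
         + A 0 2 * (A 1 0 * A 2 1 - A 1 1 * A 2 0).
Proof.
(* Indexing by naturals lets the lifted ordinals of the cofactors compute, so that [ring] sees equal
   entries as equal atoms. *)
pose f i j := A (inord i) (inord j).
have fE (i j : 'I_3) : A i j = f i j by rewrite /f !inord_val.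
rewrite (expand_det_row _ 0) !big_ord_recr big_ord0 /= /cofactor.
rewrite !(expand_det_row _ 0) !big_ord_recr !big_ord0 /= /cofactor !det_mx11.
rewrite !mxE !fE /=; ring.
Qed.

Lemma det_busmx (R : realType) (w1 w2 w3 : R) (a b c : R[i]) :
  c * b = w3%:C * a^*%C -> c * a = w1%:C * b^*%C ->
  \det (busmx w1 w2 w3 a b c) = w2%:C * (w1%:C * w3%:C - `|c| ^+ 2).
Proof.
move=> cb ca.
have ca' : c^*%C * a^*%C = w1%:C * b.
  rewrite -rmorphM ca rmorphM.
  by congr (_ * _); [exact: conjc_real | exact: conjcK].
(* By [cb], the triple product [a b c] cancels [w3 |a|^2]; by [ca'], its conjugate cancels
   [w1 |b|^2]. *)
rewrite det_mx33 !mxE sqr_normc /=; ring: cb ca'.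
Qed.

Theorem mainTheorem3 (R : realType)
    (w1 w2 w3 w12R w12I w23R w23I w31R w31I : R) :
  let W := busmx w1 w2 w3 (w12R +i* w12I) (w23R +i* w23I) (w31R +i* w31I) in
  (* second-order cone constraints *)
  0 <= w1 -> 0 <= w2 -> 0 <= w3 ->
  `|W 0 1| ^+ 2 <= (w1 * w2)%:C ->
  `|W 1 2%:R| ^+ 2 <= (w2 * w3)%:C ->
  `|W 0 2%:R| ^+ 2 <= (w1 * w3)%:C ->
  (* cycle constraints *)
  w31R * w23R - w31I * w23I = w3 * w12R ->
  w31I * w23R + w31R * w23I = - (w3 * w12I) ->
  w31R * w12R - w31I * w12I = w1 * w23R ->
  w31I * w12R + w31R * w12I = - (w1 * w23I) ->
  0 <= \det W /\ psdmx W.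
Proof.
move=> W w1_ge0 w2_ge0 w3_ge0.
(* The entry [W 0 2] is the conjugate of [W31]; [sqrrN] removes the sign of its imaginary part. *)
rewrite !mxE /= -!add_Re2_Im2 !lecR /= sqrrN => ha hb hc e1 e2 e3 e4.
have e4' : w1 * w23I = - (w31I * w12R + w31R * w12I) by rewrite e4 opprK.
split.
  rewrite det_busmx.
  - rewrite -add_Re2_Im2 -!rmorphM -rmorphB -rmorphM /=.
    by rewrite lecR mulr_ge0 // subr_ge0.
  - by apply/eqP; rewrite eq_complex; simpc; rewrite e1 addrC e2 !eqxx.
  - by apply/eqP; rewrite eq_complex; simpc; rewrite e3 addrC e4 !eqxx.
split.
  apply/is_hermitianmxP; rewrite expr0 scale1r; apply/matrixP => i j.
  rewrite !mxE; case: i => [[|[|[|//]]] ?]; case: j => [[|[|[|//]]] ?] //=;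
  by apply/eqP; rewrite eq_complex /= ?opprK ?oppr0 !eqxx.
move=> u.
rewrite !mxE !big_ord_recr big_ord0 /= !mxE !big_ord_recr !big_ord0 /= !mxE /=.
case: (u _ 0) => x1 x2; case: (u _ 0) => y1 y2; case: (u _ 0) => z1 z2; simpc.
(* Nonnegativity in [R[i]] splits into a vanishing imaginary part and a nonnegative real part. *)
apply/andP; split; first by apply/eqP; ring.
have := hermitian_form3_ge0 _ _ _ _ _ _ _ _ _ _ x1 x2 y1 y2 z1 z2 w1_ge0 w2_ge0 w3_ge0 ha hb hc (esym e3) e4'.
congr (0 <= _); ring.
Qed.
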